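(* Let $\alpha>0$ and let $X$ be a positive random variable with differentiable density $f$ and Laplace transform $\mathscr{L}_X(t)=\mathbb{E}[\exp(-tX)]$, satisfying $\mathbb{E}\left|\dfrac{X f'(X)}{f(X)}\right|<\infty$. Then $X$ has a $P(\alpha)$ distribution if and only if $$\mathscr{L}_X(t)=\mathbb{E}\left[\frac{\alpha+1}{X}\cdot\frac{\exp(-t)-\exp(-tX)}{t}\right]$$ for each $t>0$.
   Context: For $\alpha>0$, $P(\alpha)$ denotes the Pareto distribution with shape $\alpha$ and scale $1$, i.e. the distribution with density $f(x;\alpha)=\alpha x^{-\alpha-1}$ for $x\ge 1$ and $f(x;\alpha)=0$ otherwise. Here $f'$ denotes the derivative of the density $f$ of $X$. *)

(* Defs.v *)
From HB Require Import structures.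
From mathcomp Require Import all_boot all_order all_algebra.
From mathcomp Require Import all_classical all_reals all_analysis.
Set Implicit Arguments.
Unset Strict Implicit.
Unset Printing Implicit Defensive.
Import Order.TTheory GRing.Theory Num.Theory.
Import numFieldNormedType.Exports.
Local Open Scope classical_set_scope.
Local Open Scope ring_scope.

Definition pareto_pdf (R : realType) (alpha x : R) : R :=
  if 1 <= x then alpha * x `^ (- alpha - 1) else 0.

Definition has_density d (T : measurableType d) (R : realType)
    (P : probability T R) (X : {RV P >-> R}) (f : R -> R) : Prop :=
  [/\ measurable_fun setT f,
      forall x, 0 <= f x &
      forall A : set R, measurable A ->
        distribution P X A = (\int[lebesgue_measure]_(x in A) (f x)%:E)%E].

Definition pareto_distributed d (T : measurableType d) (R : realType)
    (P : probability T R) (alpha : R) (X : {RV P >-> R}) : Prop :=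
  has_density X (pareto_pdf alpha).

(* Finitely many exceptional points are allowed because a density on the line
   is rarely differentiable at the endpoints of its support: [pareto_pdf alpha]
   jumps at 1.  Everywhere differentiable densities are the case [s = [::]].
   The values of [f] on the nonpositive half-line are irrelevant for a positive
   random variable. *)
Definition differentiable_density (R : realType) (f : R -> R) : Prop :=
  exists s : seq R, forall x : R, 0 < x -> x \notin s -> derivable f x 1.

Definition laplace_transform d (T : measurableType d) (R : realType)
    (P : probability T R) (X : {RV P >-> R}) (t : R) : \bar R :=
  ('E_P[fun w => expR (- t * X w)])%E.

(* Main.v *)
Require Import Defs.
From HB Require Import structures.
From mathcomp Require Import all_boot all_order all_algebra.
From mathcomp Require Import all_classical all_reals all_analysis.
From mathcomp Require Import measurable_realfun ring lra.
Set Implicit Arguments.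
Unset Strict Implicit.
Unset Printing Implicit Defensive.
Import Order.TTheory GRing.Theory Num.Theory.
Import numFieldNormedType.Exports.
Local Open Scope classical_set_scope.
Local Open Scope ring_scope.

(** Both directions rest on the fact that [(exp(-t) - exp(-tx))/t] is the
    primitive vanishing at 1 of [exp(-tx)]: the identity says that
    [E phi(X) = (alpha+1) E[psi(X)/X]] with [psi' = phi] and [psi(1) = 0], for
    [phi(x) = exp(-tx)].  For a Pareto variable this is an integration by parts.

    Conversely, the case [t = 1] forces [E(1/X)] to be finite, and by linearity
    the identity extends to [phi(x) = 1 - (1 - exp(-ax))^N].  With
    [a = (n+1) ln 2 / c] and [N = 2^(n+1)] these functions tend to the indicator
    of [x < c], so by dominated convergence
    [P(X < c) = (alpha+1) E[(min(X,c) - min(1,c))/X]] for every [c > 0]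
    (X has no atom).  At [c = 1] the right-hand side is nonpositive, so [X >= 1]
    almost surely; for [c >= 1], comparing increments shows that
    [S(c) = P(X >= c)] satisfies [S' = - alpha S / c] with [S(1) = 1], so that
    [S(c) = c^(-alpha)]. *)

(** * Smooth cutoffs and their pointwise limits *)

Lemma bernoulli_ineq (R : realFieldType) (y : R) (n : nat) :
  -1 <= y -> 1 + y *+ n <= (1 + y) ^+ n.
Proof.
move=> y1; elim: n => [|n ih]; first by rewrite mulr0n addr0 expr0.
rewrite exprS; apply: (@le_trans _ _ ((1 + y) * (1 + y *+ n))).
  have := sqr_ge0 y; have := @mulrn_wge0 R (y ^+ 2) n (sqr_ge0 y).
  rewrite mulrDl mul1r mulrDr mulr1 mulrnAr -expr2 mulrS => h1 h2; lra.
by rewrite ler_wpM2l//; lra.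
Qed.

(* Approximates the indicator of [x < c]: [exp (- ln 2 / c * x)] crosses 1/2 at [x = c]. *)
Definition cutoff (R : realType) (c : R) (n : nat) (x : R) : R :=
  1 - (1 - expR (- (ln 2 / c * n.+1%:R) * x)) ^+ (2 ^ n.+1).

Lemma cutoff_itv (R : realType) (c x : R) (n : nat) :
  0 < c -> 0 <= x -> 0 <= cutoff c n x <= 1.
Proof.
move=> c0 x0; rewrite /cutoff; set y := expR _.
have y0 : 0 <= y := expR_ge0 _.
have y1 : y <= 1.
  rewrite expR_le1 mulNr oppr_le0 mulr_ge0// mulr_ge0// mulr_ge0 ?ln_ge0 ?ler1n//.
  by rewrite invr_ge0 ltW.
rewrite subr_ge0 gerBl exprn_ge0 ?subr_ge0// andbT.
by rewrite exprn_ile1 ?subr_ge0// gerBl.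
Qed.

Lemma cutoffE (R : realType) (c x : R) (n : nat) :
  cutoff c n x = 1 - (1 - expR (- (ln 2 / c * x)) ^+ n.+1) ^+ (2 ^ n.+1).
Proof. by rewrite /cutoff -expRM_natr !mulNr (mulrAC _ x). Qed.

(** With [v = expR (- (ln 2 / c * x))], this shows that [2 * v] exceeds 1 exactly when [x < c]. The
    powers [(2 * v) ^+ n.+1] govern both limits of the cutoff. *)
Lemma expR_ln2 (R : realType) (c x : R) : 0 < c ->
  2 * expR (- (ln 2 / c * x)) = expR (ln 2 / c * (c - x)).
Proof.
move=> c0; rewrite mulrBr divfK ?gt_eqF// expRB lnK ?posrE//.
by rewrite expRN.
Qed.

(** The defect [(1 - y) ^+ N], with [y = v ^+ n.+1] and [N = 2 ^ n.+1], lies below a geometric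
    sequence of ratio [(2 * v)^-1 < 1]. *)
Lemma cvg_cutoff_lt (R : realType) (c x : R) : 0 < x -> x < c ->
  cutoff c n x @[n --> \oo] --> (1 : R).
Proof.
move=> x0 xc; have c0 : 0 < c by exact: lt_trans xc.
have l2 : 0 < ln 2 :> R by rewrite ln_gt0// ltr1n.
set v := expR (- (ln 2 / c * x)).
have v0 : 0 < v := expR_gt0 _.
have v1 : v <= 1.
  by rewrite expR_le1 oppr_le0 mulr_ge0 ?divr_ge0 ?(ltW x0) ?(ltW c0) ?(ltW l2).
have v2 : 1 < 2 * v.
  by rewrite expR_ln2// expR_gt1 mulr_gt0 ?subr_gt0// divr_gt0.
apply: (@squeeze_cvgr _ _ _ _ (fun n => 1 - (2 * v)^-1 ^+ n.+1) (cst 1)); last 2 first.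
- rewrite -[X in _ --> X]subr0; apply: cvgB; first exact: cvg_cst.
  have h : `|(2 * v)^-1| < 1 by rewrite gtr0_norm ?invr_gt0 ?invf_lt1// (lt_trans ltr01).
  by have := @cvg_expr _ _ h; rewrite -cvg_shiftS.
- exact: cvg_cst.
near=> n; rewrite (andP (cutoff_itv n c0 (ltW x0))).2 andbT cutoffE lerD2l lerN2.
rewrite -/v; set y := v ^+ n.+1.
have y0 : 0 <= y by rewrite exprn_ge0// ltW.
have y1 : y <= 1 by rewrite exprn_ile1// ltW.
(* [(1 - y)^N (1 + N y) <= (1 - y^2)^N <= 1] with [N y = (2 v)^(n+1)] *)
rewrite exprVn -[leRHS]mul1r ler_pdivlMr ?exprn_gt0 ?(lt_trans ltr01)//.
have -> : (2 * v) ^+ n.+1 = y *+ (2 ^ n.+1) by rewrite exprMn -natrX mulr_natl.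
apply: (@le_trans _ _ ((1 - y) ^+ (2 ^ n.+1) * (1 + y) ^+ (2 ^ n.+1))).
  rewrite ler_wpM2l ?exprn_ge0 ?subr_ge0//.
  by apply: le_trans (bernoulli_ineq _ _); lra.
rewrite -exprMn exprn_ile1//.
  by rewrite mulr_ge0 ?subr_ge0// addr_ge0.
by have := sqr_ge0 y; rewrite expr2; lra.
Unshelve. all: end_near. Qed.

(** Bernoulli's inequality at [- y], with [y = v ^+ n.+1], bounds the cutoff by
    [y *+ (2 ^ n.+1) = (2 * v) ^+ n.+1], where now [2 * v < 1]. *)
Lemma cvg_cutoff_gt (R : realType) (c x : R) : 0 < c -> c < x ->
  cutoff c n x @[n --> \oo] --> (0 : R).
Proof.
move=> c0 cx; have x0 : 0 < x by exact: lt_trans cx.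
have l2 : 0 < ln 2 :> R by rewrite ln_gt0// ltr1n.
set v := expR (- (ln 2 / c * x)).
have v0 : 0 < v := expR_gt0 _.
have v1 : v <= 1.
  by rewrite expR_le1 oppr_le0 mulr_ge0 ?divr_ge0 ?(ltW x0) ?(ltW c0) ?(ltW l2).
have v2 : 2 * v < 1.
  by rewrite expR_ln2// expR_lt1 pmulr_rlt0 ?subr_lt0// divr_gt0.
apply: (@squeeze_cvgr _ _ _ _ (cst 0) (fun n => (2 * v) ^+ n.+1)); last 2 first.
- exact: cvg_cst.
- have h : `|2 * v| < 1 by rewrite ger0_norm// mulr_ge0// ltW.
  by have := @cvg_expr _ _ h; rewrite -cvg_shiftS.
near=> n; rewrite (andP (cutoff_itv n c0 (ltW x0))).1 /= cutoffE.
rewrite -/v; set y := v ^+ n.+1.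
have y1 : y <= 1 by rewrite exprn_ile1// ltW.
have -> : (2 * v) ^+ n.+1 = y *+ (2 ^ n.+1) by rewrite exprMn -natrX mulr_natl.
have := @bernoulli_ineq _ (- y) (2 ^ n.+1); rewrite mulNrn => h.
have := h ltac:(lra); lra.
Unshelve. all: end_near. Qed.

Lemma continuous_cutoff (R : realType) (c : R) (n : nat) : continuous (cutoff c n).
Proof.
move=> x; rewrite /cutoff; apply: cvgB; first exact: cvg_cst.
apply: (@continuous_comp _ _ _ (fun x => 1 - expR (- (ln 2 / c * n.+1%:R) * x))
  (fun y => y ^+ (2 ^ n.+1))); last exact: exprn_continuous.
apply: cvgB; first exact: cvg_cst.
apply: (@continuous_comp _ _ _ (fun x => - (ln 2 / c * n.+1%:R) * x) expR).
  exact: mulrl_continuous.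
exact: continuous_expR.
Qed.

(** * Primitives of the cutoffs *)

Lemma integral_below (R : realType) (a b c : R) : a <= b ->
  (\int[lebesgue_measure]_(x in `[a, b]) (\1_(`]-oo, c[ : set R) x)%:E
   = (Num.min b c - Num.min a c)%:E)%E.
Proof.
move=> ab; rewrite integral_indic//= setIC.
have [ca|ac] := leP c a.
  rewrite (min_idPr _) ?(le_trans ca)// subrr.
  rewrite (_ : _ `&` _ = set0) ?measure0//.
  apply/seteqP; split => x //= []; rewrite !in_itv/= => /andP[ax _] xc.
  by have := lt_le_trans xc (le_trans ca ax); rewrite ltxx.
have [cb|bc] := leP c b.
  rewrite (_ : _ `&` _ = `[a, c[%classic); last first.
    apply/seteqP; split => x /=; rewrite !in_itv/=.
      by move=> [/andP[-> _] ->].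
    by move=> /andP[ax xc]; rewrite ax xc (le_trans (ltW xc)).
  by rewrite lebesgue_measure_itv/= lte_fin ac.
rewrite (_ : _ `&` _ = `[a, b]%classic); last first.
  apply/seteqP; split => x /=; rewrite !in_itv/=; first by case.
  by move=> /andP[ax xb]; rewrite ax xb (le_lt_trans xb).
rewrite lebesgue_measure_itv/= lte_fin; case: ltgtP ab => //.
by move=> -> _; rewrite subrr.
Qed.

Lemma cvg_integral_cutoff (R : realType) (a b c : R) :
  0 < a -> a <= b -> 0 < c ->
  (\int[lebesgue_measure]_(x in `[a, b]) (cutoff c n x)%:E)%E @[n --> \oo]
    --> (Num.min b c - Num.min a c)%:E.
Proof.
move=> a0 ab c0; rewrite -integral_below//.
have mc n : measurable_fun [set: R] (cutoff c n).
  by apply: continuous_measurable_fun; exact: continuous_cutoff.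
have [|||||_ _] // := @dominated_convergence _ _ R (@lebesgue_measure R) `[a, b]%classic
  (measurable_itv _) (fun n x => (cutoff c n x)%:E)
  (fun x => (\1_(`]-oo, c[ : set R) x)%:E) (cst 1%E).
- by move=> n; apply/measurable_funTS/measurable_EFinP; exact: mc.
- by apply/measurable_funTS/measurable_EFinP; exact: measurable_indic.
(* At [x = c] the cutoffs are [1 - (1 - 1 / N) ^ N] with [N = 2 ^ n.+1]. They tend to [1 - exp(-1)]
   and not to 0, so this point goes into the null set. *)
- exists [set c]; split => //.
    exact: lebesgue_measure_set1.
  move=> x /= /not_implyP[]; rewrite in_itv/= => /andP[ax xb] h.
  apply: contrapT => xc; apply: h; apply: cvg_EFin; first exact: nearW.
  have [cx|xc'|cx] := ltgtP c x; last by rewrite cx in xc.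
  all: rewrite /= ?indicE.
  - rewrite memNset/=; last by rewrite in_itv/= ltNge (ltW cx).
    exact: cvg_cutoff_gt.
  - rewrite mem_set/=; last by rewrite in_itv/=.
    by apply: cvg_cutoff_lt => //; exact: lt_le_trans ax.
- apply: (@continuous_compact_integrable R (cst 1)); first exact: segment_compact.
  by apply: continuous_subspaceT => x; exact: cvg_cst.
- apply: aeW => x n /=; rewrite in_itv/= => /andP[ax xb].
  have /andP[h0 h1] := cutoff_itv n c0 (le_trans (ltW a0) ax).
  by rewrite ger0_norm// lee_fin.
Qed.

Lemma cutoff_primitive (R : realType) (c : R) (psi : R -> R) (n : nat) (a b : R) :
  (forall x : R, is_derive x 1 psi (cutoff c n x)) -> a <= b ->
  (\int[lebesgue_measure]_(x in `[a, b]) (cutoff c n x)%:E = (psi b - psi a)%:E)%E.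
Proof.
move=> dpsi; rewrite le_eqVlt => /predU1P[<-|ab].
  by rewrite set_itv1 integral_set1 subrr.
have cpsi : continuous psi.
  move=> x; apply/differentiable_continuous/derivable1_diffP.
  by case: (dpsi x).
rewrite (@continuous_FTC2 _ _ psi)// ?EFinB//.
- by apply: continuous_subspaceT; exact: continuous_cutoff.
- split.
  + by move=> x _; case: (dpsi x).
  + by apply/cvg_at_right_filter; exact: cpsi.
  + by apply/cvg_at_left_filter; exact: cpsi.
- by move=> x _; rewrite derive1E; case: (dpsi x).
Qed.

(** [psi n x] is the oriented integral of the cutoff from 1 to [x], hence the two cases and the
    change of sign when [x < 1]. *)
Lemma cvg_cutoff_primitive (R : realType) (c : R) (psi : nat -> R -> R) :
  0 < c ->
  (forall n (x : R), is_derive x 1 (psi n) (cutoff c n x)) -> (forall n, psi n 1 = 0) ->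
  forall x, 0 < x -> psi n x @[n --> \oo] --> Num.min x c - Num.min 1 c.
Proof.
move=> c0 dpsi psi1 x x0.
have [x1|x1] := leP 1 x.
  have := @cvg_integral_cutoff R 1 x c ltr01 x1 c0.
  under eq_fun do rewrite (cutoff_primitive (dpsi _) x1) psi1 subr0.
  exact: fine_cvg.
have := @cvg_integral_cutoff R x 1 c x0 (ltW x1) c0.
under eq_fun do rewrite (cutoff_primitive (dpsi _) (ltW x1)) psi1 sub0r.
move=> /fine_cvg /cvgN; rewrite opprB.
by apply: cvg_trans; apply: near_eq_cvg; apply: nearW => n /=; rewrite opprK.
Qed.

(** The cutoffs lie between 0 and 1, so by the mean value theorem [psi] is 1-Lipschitz on the
    positive half-line. Divided by [x], the bound becomes [1 + 1 / x], uniform in [n]: the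
    dominating function of [prob_below]. *)
Lemma cutoff_primitive_le (R : realType) (c : R) (psi : R -> R) (n : nat) (x : R) :
  0 < c ->
  (forall x : R, is_derive x 1 psi (cutoff c n x)) -> psi 1 = 0 ->
  0 < x -> `|psi x| <= 1 + x.
Proof.
move=> c0 dpsi psi1 x0.
have cpsi : continuous psi.
  move=> y; apply/differentiable_continuous/derivable1_diffP.
  by case: (dpsi y).
have key (a b : R) : 0 < a -> a <= b -> `|psi b - psi a| <= b - a.
  move=> a0 ab.
  have [y /itvP yab ->] := @MVT_segment R psi (cutoff c n) a b ab
    (fun y _ => dpsi y) (continuous_subspaceT cpsi).
  have y0 : 0 <= y by rewrite (le_trans (ltW a0))// yab.
  have /andP[h0 h1] := cutoff_itv n c0 y0.
  by rewrite normrM (ger0_norm h0) ger0_norm ?subr_ge0// ler_piMl// subr_ge0.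
have [x1|x1] := leP 1 x.
  by have := key _ _ ltr01 x1; rewrite psi1 subr0 => /le_trans; apply; lra.
by have := key _ _ x0 (ltW x1); rewrite psi1 sub0r normrN => /le_trans; apply; lra.
Qed.

(** * The differential equation of the survival function *)

(** Put [q y = alpha * S y / y]. The increment bounds trap the difference quotients of [S] between
    two values of [- q]. They also make [S], and then [q], Lipschitz beyond 1, so the error is at
    most a multiple of [|h|]. *)
Lemma is_derive_survival (R : realType) (alpha : R) (S : R -> R) (x : R) :
  0 < alpha -> (forall y, 0 <= S y <= 1) ->
  (forall a b, 1 <= a -> a <= b ->
    (b - a) * (alpha * S b / b) <= S a - S b <= (b - a) * (alpha * S a / a)) ->
  1 < x -> is_derive x 1 S (- (alpha * S x / x)).
Proof.
move=> a0 S01 hS x1.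
have x0 : 0 < x by exact: lt_trans x1.
have S0 y : 0 <= S y by case/andP: (S01 y).
have S1 y : S y <= 1 by case/andP: (S01 y).
have lip a b : 1 <= a -> a <= b -> 0 <= S a - S b <= alpha * (b - a).
  move=> a1 ab; have a0' : 0 < a by exact: lt_le_trans a1.
  have b0 : 0 < b by exact: lt_le_trans ab.
  have /andP[h1 h2] := hS _ _ a1 ab.
  rewrite (le_trans _ h1)/=; last first.
    by rewrite mulr_ge0 ?subr_ge0// divr_ge0 ?(ltW b0)// mulr_ge0// ltW.
  apply: (le_trans h2); rewrite mulrC ler_wpM2r ?subr_ge0//.
  rewrite ler_pdivrMr// ler_pM2l//; exact: le_trans a1.
pose q y := alpha * S y / y.
have q_lip a b : 1 <= a -> a <= b -> 0 <= q a - q b <= alpha * (alpha + 1) * (b - a).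
  move=> a1 ab; have a0' : 0 < a by exact: lt_le_trans a1.
  have b0 : 0 < b by exact: lt_le_trans ab.
  have b1 : 1 <= b by exact: le_trans ab.
  have /andP[l0 l1] := lip _ _ a1 ab.
  have -> : q a - q b = alpha * (S a * (b - a) + a * (S a - S b)) / (a * b).
    by rewrite /q; field; rewrite !gt_eqF.
  have n0 : 0 <= S a * (b - a) + a * (S a - S b).
    apply: addr_ge0; first by rewrite mulr_ge0 ?subr_ge0.
    by rewrite mulr_ge0// ltW.
  have ab0 : 0 < a * b by rewrite mulr_gt0.
  apply/andP; split.
    by apply: divr_ge0; [apply: mulr_ge0 => //; exact: ltW|exact: ltW].
  rewrite ler_pdivrMr// -!mulrA ler_pM2l//.
  (* Origin of [alpha * (alpha + 1)]: the first term is at most [a * b * (b - a)] because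
     [S a <= 1 <= a * b], the second at most [alpha] times this by the Lipschitz bound on [S]. *)
  have : S a * (b - a) <= a * b * (b - a).
    rewrite ler_wpM2r ?subr_ge0//; apply: (le_trans (S1 a)).
    by apply: (le_trans a1); rewrite ler_peMr// ltW.
  have : a * (S a - S b) <= a * (b * (alpha * (b - a))).
    rewrite ler_pM2l//; apply: (le_trans l1); rewrite ler_peMl//.
    by rewrite mulr_ge0 ?subr_ge0// ltW.
  lra.
have quot : (fun h : R => h^-1 *: (S (h *: (1 : R) + x) - S x)) @ 0^' --> - q x.
  pose C := alpha * (alpha + 1).
  have C0 : 0 < C by rewrite mulr_gt0// addr_gt0.
  apply/cvgrPdist_le => e e0.
  (* The radius [x - 1] keeps [h + x] above 1, where the increment bounds hold; [e / C] makes
     [C * |h|] smaller than [e]. *)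
  have d0 : 0 < Num.min (e / C) (x - 1) by rewrite lt_min divr_gt0// subr_gt0.
  exists (Num.min (e / C) (x - 1)) => //= h; rewrite /ball_/= sub0r normrN lt_min.
  move=> /andP[hC hx] h0.
  rewrite /GRing.scale/= mulr1.
  suff : `|- q x - h^-1 * (S (h + x) - S x)| <= C * `|h|.
    move=> /le_trans; apply; rewrite mulrC -ler_pdivlMr//; exact: ltW.
  have : h != 0 by [].
  case: (ltgtP h 0) => // hs _.
  - rewrite ltr0_norm// in hx *.
    have y1 : 1 <= h + x by lra.
    have yx : h + x <= x by lra.
    have /andP[q0 q1] := q_lip _ _ y1 yx.
    have /andP[s0 s1] := hS _ _ y1 yx.
    rewrite -/(q _) in s0; rewrite -/(q _) in s1.
    have -> : h^-1 * (S (h + x) - S x) = - ((S (h + x) - S x) / (- h)).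
      by field; rewrite lt_eqF.
    set r := _ / - h.
    have r1 : r <= q (h + x) by rewrite ler_pdivrMr ?oppr_gt0//; lra.
    have r0 : q x <= r by rewrite ler_pdivlMr ?oppr_gt0//; lra.
    rewrite ler_norml /C; lra.
  - rewrite gtr0_norm// in hx *.
    have xy : x <= h + x by lra.
    have /andP[q0 q1] := q_lip _ _ (ltW x1) xy.
    have /andP[s0 s1] := hS _ _ (ltW x1) xy.
    rewrite -/(q _) in s0; rewrite -/(q _) in s1.
    have -> : h^-1 * (S (h + x) - S x) = - ((S x - S (h + x)) / h).
      by field; rewrite gt_eqF.
    set r := _ / h.
    have r1 : r <= q x by rewrite ler_pdivrMr//; lra.
    have r0 : q (h + x) <= r by rewrite ler_pdivlMr//; lra.
    rewrite ler_norml /C; lra.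
split; first by apply/cvg_ex; exists (- q x).
exact: cvg_lim quot.
Qed.

(** The differential equation makes the product [r] of [S y] and the power [alpha] of [y] constant.
    The derivative is known only beyond 1, so continuity at the endpoint 1 is derived from the
    increment bounds. *)
Lemma survivalE (R : realType) (alpha : R) (S : R -> R) :
  0 < alpha -> (forall y, 0 <= S y <= 1) -> S 1 = 1 ->
  (forall a b, 1 <= a -> a <= b ->
    (b - a) * (alpha * S b / b) <= S a - S b <= (b - a) * (alpha * S a / a)) ->
  forall x, 1 <= x -> S x = x `^ (- alpha).
Proof.
move=> a0 S01 S1 hS x; rewrite le_eqVlt => /predU1P[<-|x1].
  by rewrite S1 powR1.
have dS (y : R) : 1 < y -> is_derive y 1 S (- (alpha * S y / y)).
  exact: is_derive_survival.
pose r (y : R) : R := S y * y `^ alpha.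
have dr (y : R) : 1 < y -> is_derive y 1 r 0.
  move=> y1; have y0 : 0 < y by exact: lt_trans y1.
  have := dS y y1 => dSy.
  have dp := is_derive1_powR alpha y0.
  apply: is_derive_eq; rewrite /GRing.scale/= powRB ?(gt_eqF y0) ?implybT//.
  by rewrite powRr1 ?(ltW y0)//; field; rewrite gt_eqF.
have cr : {within `[1, x], continuous r}.
  apply/continuous_within_itvP => //; split.
  - move=> y; rewrite in_itv/= => /andP[y1 _].
    by apply/differentiable_continuous/derivable1_diffP; case: (dr _ y1).
  - apply: cvgM; last first.
      apply/cvg_at_right_filter.
      have h : derivable (fun y : R => y `^ alpha) (1 : R) 1.
        by apply: derivable_powR; rewrite in_itv/= andbT.
      have h' : {for 1, continuous (fun y : R => y `^ alpha)}.
        exact/differentiable_continuous/derivable1_diffP.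
      exact: h'.
    apply/cvgrPdist_le => e e0; near=> y.
    have y1 : 1 <= y by near: y; apply: nbhs_right_ge.
    have /andP[h1 h2] := hS _ _ (lexx 1) y1.
    rewrite ger0_norm; last first.
      apply: le_trans h1; apply: mulr_ge0; first by rewrite subr_ge0.
      apply: divr_ge0; last exact: le_trans y1.
      by apply: mulr_ge0; [exact: ltW|case/andP: (S01 y)].
    apply: (le_trans h2); rewrite S1 divr1 mulr1 -ler_pdivlMr// lerBlDl.
    by near: y; apply: nbhs_right_le; rewrite ltrDl divr_gt0.
  - apply/cvg_at_left_filter.
    by apply/differentiable_continuous/derivable1_diffP; case: (dr _ x1).
have dr' y : y \in `]1, x[ -> is_derive y 1 r 0.
  by rewrite in_itv/= => /andP[y1 _]; exact: dr.
have [y _] := MVT x1 dr' cr.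
rewrite mul0r /r S1 powR1 mul1r => /eqP; rewrite subr_eq0 => /eqP rx.
have x0 : 0 < x by exact: lt_trans x1.
by rewrite powRN -[RHS]mul1r -rx mulfK// gt_eqF// powR_gt0.
Unshelve. all: end_near. Qed.

(** * Measurability and integrability tools *)

Lemma measurable_inv (R : realType) : measurable_fun [set: R] (@GRing.inv R).
Proof.
have o0 : open (~` [set (0 : R)]) by apply: closed_openC; exact: closed_eq.
rewrite -(setvU [set (0 : R)]); apply/measurable_funU.
- by apply: measurableC.
- by [].
split; last exact: measurable_fun_set1.
apply: open_continuous_measurable_fun => // x; rewrite inE/= => /eqP x0.
exact: inv_continuous.
Qed.

Lemma integral_full_set d (T : measurableType d) (R : realType)
    (P : probability T R) (D : set T) (h : T -> R) :
  measurable D -> P D = 1%E -> measurable_fun setT h ->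
  (\int[P]_w (h w)%:E = \int[P]_(w in D) (h w)%:E)%E.
Proof.
move=> mD PD mh; have mh' : measurable_fun setT (EFin \o h) by exact/measurable_EFinP.
rewrite [RHS]integral_mkcond; apply: ae_eq_integral => //.
  by apply/(measurable_restrictT _ mD)/measurable_funTS.
exists (~` D); split; first exact: measurableC.
  by have := probability_setC P mD; rewrite PD subee.
move=> w /= /not_implyP[_ h1] Dw; apply: h1.
by rewrite /restrict mem_set.
Qed.

(** If the negative part had infinite integral, the finite integral of the positive part would force
    the integral of [f] to be [-oo]. *)
Lemma integrable_gtNy d (T : measurableType d) (R : realType)
    (mu : {measure set T -> \bar R}) (D : set T) (f : T -> \bar R) :
  measurable D -> measurable_fun D f ->
  (-oo < \int[mu]_(x in D) f x)%E -> (\int[mu]_(x in D) f^\+ x < +oo)%E ->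
  mu.-integrable D f.
Proof.
move=> mD mf h2 fp; apply/integrableP; split => //.
under eq_integral do rewrite -/((abse \o f) _) fune_abse.
rewrite ge0_integralD//; [|exact: measurable_funepos|exact: measurable_funeneg].
rewrite lte_add_pinfty// ltey; apply/eqP => fn.
by move: h2; rewrite integralE fn addeC.
Qed.

Lemma measurable_RV_ge d (T : measurableType d) (R : realType)
    (P : probability T R) (X : {RV P >-> R}) (c : R) :
  measurable [set w | c <= X w].
Proof.
have -> : [set w | c <= X w] = X @^-1` `[c, +oo[.
  by apply/seteqP; split => w /=; rewrite in_itv/= andbT.
exact: measurable_funPTI.
Qed.

Lemma measurable_RV_lt d (T : measurableType d) (R : realType)
    (P : probability T R) (X : {RV P >-> R}) (c : R) :
  measurable [set w | X w < c].
Proof.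
have -> : [set w | X w < c] = X @^-1` `]-oo, c[.
  by apply/seteqP; split => w /=; rewrite in_itv.
exact: measurable_funPTI.
Qed.

(** * Test functions satisfying the identity *)

Section identity.
Context d (T : measurableType d) (R : realType) (P : probability T R).
Context (alpha : R) (X : {RV P >-> R}).
Hypothesis alpha0 : 0 < alpha.
Let D := [set w | 0 < X w].
Hypothesis PD : P D = 1%E.

Let mX : measurable_fun setT X. Proof. exact: measurable_funP. Qed.

Let mD : measurable D.
Proof.
have -> : D = X @^-1` `]0, +oo[ by apply/seteqP; split => w /=; rewrite in_itv/= andbT.
by rewrite -[_ @^-1` _]setTI; exact: mX.
Qed.

Let mVX : measurable_fun setT (fun w => (X w)^-1).
Proof. exact: (measurableT_comp (@measurable_inv R) mX). Qed.

Hypothesis hE : forall t : R, 0 < t ->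
  laplace_transform X t =
  'E_P[fun w => ((alpha + 1) / X w * ((expR (- t) - expR (- t * X w)) / t))%R]%E.

Let Y (t : R) w := (alpha + 1) / X w * ((expR (- t) - expR (- t * X w)) / t).

Let mE (t : R) : measurable_fun setT (fun w => expR (- t * X w)).
Proof. by apply: (measurableT_comp (@measurable_expR R)); exact: measurable_funM. Qed.

Let mY t : measurable_fun setT (Y t).
Proof.
apply: measurable_funM; first exact: measurable_funM.
by apply: measurable_funM => //; apply: measurable_funB.
Qed.

Let hE' (t : R) : 0 < t ->
  (\int[P]_(w in D) (expR (- t * X w))%:E = \int[P]_(w in D) (Y t w)%:E)%E.
Proof.
move=> t0; have := hE t0; rewrite /laplace_transform unlock.
by rewrite (integral_full_set mD PD (mE t)) (integral_full_set mD PD (mY t)).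
Qed.

Let integrable_bounded (h : T -> R) (M : R) : measurable_fun setT h ->
  (forall w, D w -> `|h w| <= M) -> P.-integrable D (EFin \o h).
Proof.
move=> mh hM; have M0 w : D w -> 0 <= M by move=> /hM; exact: le_trans.
apply: (@le_integrable _ _ _ P D mD _ (EFin \o cst M)).
- by apply/measurable_EFinP/measurable_funTS.
- by move=> w Dw /=; rewrite lee_fin (ger0_norm (M0 _ Dw)) hM.
- exact: finite_measure_integrable_cst.
Qed.

Let iE (t : R) : 0 < t -> P.-integrable D (EFin \o (fun w => expR (- t * X w))).
Proof.
move=> t0; apply: (@integrable_bounded _ 1) => // w /= Dw.
by rewrite ger0_norm ?expR_ge0// expR_le1 mulNr oppr_le0 mulr_ge0// ltW.
Qed.

(** At [t = 1] the identity makes the integral of [Y 1] nonnegative, while [Y 1 <= alpha + 1] on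
    [D]; hence [Y 1] is integrable. For small [X] it is of order [- 1 / X], so it controls
    [1 / X]. *)
Lemma integrable_invX : P.-integrable D (EFin \o (fun w => (X w)^-1)).
Proof.
have iY : P.-integrable D (EFin \o Y 1).
  apply: integrable_gtNy => //.
  - by apply/measurable_EFinP/measurable_funTS.
  - rewrite -hE'// (@lt_le_trans _ _ 0%E)//.
    by apply: integral_ge0 => w _; rewrite lee_fin expR_ge0.
  apply: (@le_lt_trans _ _ (\int[P]_(w in D) (alpha + 1)%:E)%E).
    apply: ge0_le_integral => //.
    - by apply/measurable_funepos/measurable_EFinP/measurable_funTS.
    move=> w Dw; rewrite funeposE/=; rewrite -EFin_max lee_fin ge_max addr_ge0 ?(ltW alpha0)// andbT.
    rewrite /Y divr1 -mulrA ler_piMr ?addr_ge0 ?(ltW alpha0)//.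
    rewrite mulrC ler_pdivrMr// mul1r.
    have := expR_ge1Dx (- X w); have := expR_ge1Dx (X w).
    have : expR (- (1 : R)) <= 1 by rewrite expR_le1 lerN10.
    rewrite mulN1r; lra.
  by apply: integrable_lty => //; exact: finite_measure_integrable_cst.
have d0 : 0 < 1 - expR (-1) :> R by rewrite subr_gt0 expR_lt1 ltrN10.
(* From [1 - x <= exp(-x)] comes [(1 - exp(-1)) / x <= 1 + (exp(-x) - exp(-1)) / x]; at [x = X w]
   the last quotient is [- Y 1 w / (alpha + 1)]. *)
pose g w := (1 - expR (-1))^-1 * (1 + (alpha + 1)^-1 * `|Y 1 w|).
apply: (@le_integrable _ _ _ P D mD _ (EFin \o g)).
- by apply/measurable_EFinP/measurable_funTS.
- move=> w Dw; rewrite /= lee_fin [leRHS]ger0_norm; last first.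
    rewrite /g mulr_ge0 ?invr_ge0 ?(ltW d0)// addr_ge0// mulr_ge0 ?invr_ge0//.
    by rewrite addr_ge0// ltW.
  rewrite ger0_norm ?invr_ge0 ?(ltW Dw)// /g mulrC ler_pdivlMr//.
  have hY : Y 1 w = - (alpha + 1) * ((expR (- X w) - expR (-1)) / X w).
    by rewrite /Y divr1 mulN1r -opprB; ring.
  have a0 : 0 < alpha + 1 by rewrite addr_gt0.
  rewrite hY normrM normrN (gtr0_norm a0) mulKf ?gt_eqF//.
  apply: (le_trans _ (_ : 1 + (expR (- X w) - expR (-1)) / X w <= _)); last first.
    by rewrite lerD2l ler_norm.
  rewrite -(ler_pM2r Dw) mulrDl divfK ?gt_eqF// mulrAC mulVf ?gt_eqF// mul1r.
  have := expR_ge1Dx (- X w); lra.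
- pose h : T -> \bar R := (fun w => (alpha + 1)^-1%:E * (abse \o (EFin \o Y 1)) w)%E.
  rewrite (_ : EFin \o g = fun w => ((1 - expR (-1))^-1%:E *
     ((EFin \o cst 1%R) \+ h) w)%E); last by apply/funext => w /=.
  apply: integrableZl => //; apply: integrableD => //.
    exact: finite_measure_integrable_cst.
  by apply: integrableZl => //; exact: integrable_abse.
Qed.

(** Integrability is built in so that the class is stable under linear combinations. *)
Let balanced (phi : R -> R) := exists psi : R -> R, [/\ psi 1 = 0,
  forall x : R, is_derive x 1 psi (phi x),
  P.-integrable D (EFin \o (phi \o X)),
  P.-integrable D (EFin \o (fun w => psi (X w) / X w)) &
  \int[P]_(w in D) phi (X w) = (alpha + 1) * \int[P]_(w in D) (psi (X w) / X w)].

(** The equation is the assumed identity at [t]. On the positive half-line [|psi| <= 1 / t], so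
    integrability of [1 / X] suffices. *)
Let balanced_expR (t : R) : 0 < t -> balanced (fun x => expR (- t * x)).
Proof.
move=> t0; pose psi (x : R) : R := (expR (- t) - expR (- t * x)) / t.
have ipsi : P.-integrable D (EFin \o (fun w => psi (X w) / X w)).
  pose g w := t^-1 * (X w)^-1.
  apply: (@le_integrable _ _ _ P D mD _ (EFin \o g)).
  - apply/measurable_EFinP/measurable_funTS/measurable_funM => //.
    by apply: measurable_funM => //; apply: measurable_funB.
  - move=> w Dw; rewrite /= lee_fin /g !normrM ler_wpM2r// [leRHS]ger0_norm ?invr_ge0 ?(ltW t0)//.
    rewrite (ger0_norm (_ : 0 <= t^-1)) ?invr_ge0 ?(ltW t0)// ler_piMl ?invr_ge0 ?(ltW t0)//.
    have h1 : expR (- t) <= 1 by rewrite expR_le1 oppr_le0 ltW.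
    have h2 : expR (- t * X w) <= 1 by rewrite expR_le1 mulNr oppr_le0 mulr_ge0// ltW.
    have h3 := expR_ge0 (- t); have h4 := expR_ge0 (- t * X w).
    by rewrite ler_norml; lra.
  - exact: (integrableZl mD t^-1 integrable_invX).
exists psi; split.
- by rewrite /psi mulr1 subrr mul0r.
- move=> x; rewrite /psi; apply: is_derive_eq.
  rewrite scaler0 !add0r mul1r /GRing.scale/= mulr1.
  by field; rewrite gt_eqF.
- exact: iE.
- by [].
have := hE' t0; rewrite /Rintegral => ->; rewrite -/(Rintegral P D (Y t)).
rewrite -RintegralZl//; apply: eq_Rintegral => w _.
by rewrite /Y /psi; ring.
Qed.

Let balancedD phi1 phi2 : balanced phi1 -> balanced phi2 ->
  balanced (fun x => phi1 x + phi2 x).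
Proof.
move=> [psi1 [p1 d1 i1 j1 e1]] [psi2 [p2 d2 i2 j2 e2]].
have E : (fun w => (psi1 (X w) + psi2 (X w)) / X w) =
         (fun w => psi1 (X w) / X w + psi2 (X w) / X w).
  by apply/funext => w; rewrite mulrDl.
exists (fun x => psi1 x + psi2 x); split.
- by rewrite p1 p2 addr0.
- by move=> x; exact: is_deriveD.
- exact: (integrableD mD i1 i2).
- by rewrite E; exact: (integrableD mD j1 j2).
- by rewrite E !RintegralD// e1 e2 mulrDr.
Qed.

Let balancedZ (k : R) phi : balanced phi -> balanced (fun x => k * phi x).
Proof.
move=> [psi [p1 d1 i1 j1 e1]].
have E : (fun w => k * psi (X w) / X w) = (fun w => k * (psi (X w) / X w)).
  by apply/funext => w; rewrite mulrA.
exists (fun x => k * psi x); split.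
- by rewrite p1 mulr0.
- by move=> x; exact: is_deriveZ.
- exact: (integrableZl mD k i1).
- by rewrite E; exact: (integrableZl mD k j1).
- by rewrite E !RintegralZl// e1 mulrCA.
Qed.

Let balancedB phi1 phi2 : balanced phi1 -> balanced phi2 ->
  balanced (fun x => phi1 x - phi2 x).
Proof.
move=> h1 /(balancedZ (-1)) /(balancedD h1); congr balanced.
by apply/funext => x; rewrite mulN1r.
Qed.

(** Expanding one factor [1 - expR (- a * x)] gives a difference of two monomials of lower [N], with
    exponents [k.+1] and [k.+2]. Exponents start at 1 so that the base case is an exponential of
    positive rate. *)
Let balanced_monomial (a : R) k N : 0 < a ->
  balanced (fun x => expR (- a * x) ^+ k.+1 * (1 - expR (- a * x)) ^+ N).
Proof.
move=> a0; elim: N k => [|N ih] k.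
  rewrite (_ : (fun _ => _) = fun x => expR (- (a * k.+1%:R) * x)).
    by apply: balanced_expR; rewrite mulr_gt0.
  by apply/funext => x; rewrite expr0 mulr1 -expRM_natr; congr expR; ring.
have := balancedB (ih k) (ih k.+1); congr balanced; apply/funext => x.
by rewrite !exprS; ring.
Qed.

(** Passing from [N] to [N.+1] adds the monomial with [k = 0]. The induction starts at the zero
    function, so the constant 1 never has to be balanced by itself. *)
Let balanced_compl (a : R) N : 0 < a ->
  balanced (fun x => 1 - (1 - expR (- a * x)) ^+ N).
Proof.
move=> a0; elim: N => [|N ih].
  have := balancedB (balanced_expR a0) (balanced_expR a0).
  by congr balanced; apply/funext => x; rewrite expr0 !subrr.
have := balancedD ih (balanced_monomial 0 N a0); congr balanced.
by apply/funext => x; rewrite expr1 exprS; ring.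
Qed.

Let balanced_cutoff (c : R) n : 0 < c -> balanced (cutoff c n).
Proof.
move=> c0; apply: balanced_compl; rewrite mulr_gt0// divr_gt0//.
by rewrite ln_gt0// ltr1n.
Qed.

(** * The distribution function as a limit of cutoffs *)

Hypothesis noatom : forall c : R, P [set w | X w = c] = 0%E.

(** Both sides of the balanced identity for [cutoff c n] pass to the limit by dominated convergence,
    with bounds 1 and [1 + 1 / X]. Absence of atoms disposes of the event [X = c]. *)
Lemma prob_below (c : R) : 0 < c ->
  P.-integrable D (EFin \o (fun w => (Num.min (X w) c - Num.min 1 c) / X w)) /\
  fine (P [set w | X w < c]) =
  (alpha + 1) * \int[P]_(w in D) ((Num.min (X w) c - Num.min 1 c) / X w).
Proof.
move=> c0.
have /choice[psi hpsi] : forall n, exists psi : R -> R, [/\ psi 1 = 0,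
  forall x : R, is_derive x 1 psi (cutoff c n x),
  P.-integrable D (EFin \o (cutoff c n \o X)),
  P.-integrable D (EFin \o (fun w => psi (X w) / X w)) &
  \int[P]_(w in D) cutoff c n (X w) = (alpha + 1) * \int[P]_(w in D) (psi (X w) / X w)].
  by move=> n; exact: balanced_cutoff.
have psi1 n : psi n 1 = 0 by case: (hpsi n).
have dpsi n (x : R) : is_derive x 1 (psi n) (cutoff c n x) by case: (hpsi n).
have mlt : measurable [set w | X w < c] by exact: measurable_RV_lt.
have [|||||_ _ cvg1] := @dominated_convergence _ _ R P D mD
  (fun n w => (cutoff c n (X w))%:E) (fun w => (\1_[set w | X w < c] w)%:E) (cst 1%E).
- by move=> n; case: (hpsi n) => _ _ /integrableP[].
- by apply/measurable_funTS/measurable_EFinP; exact: measurable_indic.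
- exists [set w | X w = c]; split.
  + exact: (measurable_funPTI X (measurable_set1 c)).
  + exact: noatom.
  move=> w /= /not_implyP[Dw h]; apply: contrapT => Xc; apply: h.
  apply: cvg_EFin; first exact: nearW.
  have [cx|xc|cx] := ltgtP c (X w); last by case: Xc.
  all: rewrite /= ?indicE.
  + rewrite memNset/=; last by apply/negP; rewrite -leNgt ltW.
    exact: cvg_cutoff_gt.
  + by rewrite mem_set//; exact: cvg_cutoff_lt.
- exact: finite_measure_integrable_cst.
- apply: aeW => w n Dw /=.
  have /andP[h0 h1] := cutoff_itv n c0 (ltW Dw).
  by rewrite ger0_norm// lee_fin.
have [|||||i2 _ cvg2] := @dominated_convergence _ _ R P D mD
  (fun n w => (psi n (X w) / X w)%:E)
  (fun w => ((Num.min (X w) c - Num.min 1 c) / X w)%:E)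
  (fun w => ((EFin \o cst 1%R) \+ (EFin \o (fun w => (X w)^-1%R))) w)%E.
- by move=> n; case: (hpsi n) => _ _ _ /integrableP[].
- apply/measurable_funTS/measurable_EFinP/measurable_funM => //.
  by apply: measurable_funB => //; exact: measurable_minr.
- apply: aeW => w Dw; apply: cvg_EFin; first exact: nearW.
  by apply: cvgMr_tmp; exact: cvg_cutoff_primitive.
- apply: integrableD => //; first exact: finite_measure_integrable_cst.
  exact: integrable_invX.
- apply: aeW => w n Dw /=; rewrite lee_fin normrM (ger0_norm (_ : 0 <= (X w)^-1)) ?invr_ge0 ?(ltW Dw)//.
  rewrite ler_pdivrMr// mulrDl mulVf ?gt_eqF// mul1r addrC.
  by rewrite (cutoff_primitive_le c0 (dpsi n)).
split=> //.
have -> : fine (P [set w | X w < c]) = fine (\int[P]_(w in D) (\1_[set w | X w < c] w)%:E)%E.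
  rewrite -(integral_full_set mD PD); last exact: measurable_indic.
  by rewrite integral_indic// setIT.
have L1 : \int[P]_(w in D) cutoff c n (X w) @[n --> \oo] -->
    fine (\int[P]_(w in D) (\1_[set w | X w < c] w)%:E)%E.
  apply: fine_cvg; rewrite fineK//.
  apply: integrable_fin_num => //.
  apply: (integrableS measurableT) => //; exact: integrable_indic.
have L2 : \int[P]_(w in D) (psi n (X w) / X w) @[n --> \oo] -->
    \int[P]_(w in D) ((Num.min (X w) c - Num.min 1 c) / X w).
  by apply: fine_cvg; rewrite fineK//; exact: integrable_fin_num.
apply: (cvg_unique _ L1) => //.
rewrite (_ : (fun n => \int[P]_(w in D) cutoff c n (X w)) =
  (fun n => (alpha + 1) * \int[P]_(w in D) (psi n (X w) / X w))).
  by apply: cvgM => //; exact: cvg_cst.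
by apply/funext => n; case: (hpsi n).
Qed.

(* In terms of [F], [H] and [K], [prob_below] reads [alpha F = (alpha + 1) (K - c H)],
   and letting [c] tend to infinity gives [(alpha + 1) K = alpha]. *)
Let F (c : R) := fine (P [set w | X w < c]).
Let H (c : R) := \int[P]_(w in D) (\1_[set w | c <= X w] w / X w).
Let K := \int[P]_(w in D) (X w)^-1.

Let mlt (c : R) : measurable [set w | X w < c]. Proof. exact: measurable_RV_lt. Qed.

Let mge (c : R) : measurable [set w | c <= X w]. Proof. exact: measurable_RV_ge. Qed.

Let iH (c : R) : P.-integrable D (EFin \o (fun w => \1_[set w | c <= X w] w / X w)).
Proof.
apply: (le_integrable mD _ _ integrable_invX).
- apply/measurable_EFinP/measurable_funTS/measurable_funM => //.
- move=> w Dw; rewrite /= lee_fin normrM ler_piMl// ger0_norm//.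
Qed.

Let FE c : 1 <= c -> F c = (alpha + 1) * \int[P]_(w in D) ((Num.min (X w) c - 1) / X w).
Proof.
move=> c1; have c0 : 0 < c by exact: lt_le_trans c1.
by rewrite /F (prob_below c0).2 (min_idPl c1).
Qed.

Let iF c : 1 <= c -> P.-integrable D (EFin \o (fun w => (Num.min (X w) c - 1) / X w)).
Proof.
move=> c1; have c0 : 0 < c by exact: lt_le_trans c1.
by have := (prob_below c0).1; rewrite (min_idPl c1).
Qed.

(** The integrand [(min(X, 1) - 1) / X] is nonpositive, and a probability is nonnegative. *)
Let F1 : F 1 = 0.
Proof.
apply/eqP; rewrite eq_le fine_ge0// andbT FE// pmulr_rle0 ?addr_gt0//.
rewrite -oppr_ge0 -(mulN1r (Rintegral _ _ _)) -RintegralZl//; last exact: iF.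
apply: Rintegral_ge0 => w Dw; rewrite mulN1r -mulNr opprB divr_ge0 ?(ltW Dw)//.
by rewrite subr_ge0 ge_min lexx orbT.
Qed.

Let indic_ge (c : R) w : \1_[set w | c <= X w] w = (c <= X w)%R%:R :> R.
Proof. by rewrite indicE; case: (boolP (c <= X w)) => h; [rewrite mem_set|rewrite memNset//; exact/negP]. Qed.

(** [min(X, c') - min(X, c)] is [c' - c] where [X >= c'], 0 where [X < c], and between these values
    elsewhere. *)
Let F_increment (c c' : R) : 1 <= c -> c <= c' ->
  (alpha + 1) * ((c' - c) * H c') <= F c' - F c <= (alpha + 1) * ((c' - c) * H c).
Proof.
move=> c1 cc'; have c'1 := le_trans c1 cc'.
have a0 : 0 < alpha + 1 by rewrite addr_gt0.
have iB := integrableB mD (iF c'1) (iF c1).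
rewrite !FE// -mulrBr !ler_pM2l// -(RintegralB mD (iF c'1) (iF c1)).
rewrite -(RintegralZl _ mD (iH c)) -(RintegralZl _ mD (iH c')).
have iZ (a : R) := integrableZl mD (c' - c) (iH a).
apply/andP; split;
  [apply: (le_Rintegral mD (iZ c') iB)|apply: (le_Rintegral mD iB (iZ c))];
  move=> w Dw /=; rewrite -mulrBl mulrA ler_pM2r ?invr_gt0//.
- rewrite indic_ge; case: (leP c' (X w)) => h; rewrite ?mulr1 ?mulr0.
    by rewrite ?(min_idPr h) (min_idPr (le_trans cc' h)); lra.
  have : Num.min (X w) c <= X w by rewrite ge_min lexx.
  by rewrite ?(min_idPl (ltW h)); lra.
- rewrite indic_ge; case: (leP c (X w)) => h; rewrite ?mulr1 ?mulr0.
    have : Num.min (X w) c' <= c' by rewrite ge_min lexx orbT.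
    by rewrite ?(min_idPr h); lra.
  by rewrite ?(min_idPl (ltW h)) (min_idPl (ltW (lt_le_trans h cc'))); lra.
Qed.

(** Pointwise, [(min(X, c) - 1) / X] is the indicator of [X < c], plus [c / X] restricted to
    [X >= c], minus [1 / X]. *)
Let FH c : 1 <= c -> alpha * F c = (alpha + 1) * (K - c * H c).
Proof.
move=> c1; suff : F c = (alpha + 1) * (F c + (c * H c - K)) by lra.
have iZ := integrableZl mD c (iH c).
have iI : P.-integrable D (EFin \o \1_[set w | X w < c]).
  by apply: (integrableS measurableT) => //; exact: integrable_indic.
rewrite {1}FE//; congr (_ * _).
have -> : F c = \int[P]_(w in D) \1_[set w | X w < c] w.
  by rewrite /Rintegral -(integral_full_set mD PD)// integral_indic// setIT.
rewrite /H /K -(RintegralZl c mD (iH c)) -(RintegralB mD iZ integrable_invX).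
rewrite -(RintegralD mD iI (integrableB mD iZ integrable_invX)).
apply: eq_Rintegral => w; rewrite inE => Dw.
have X0 : X w != 0 by rewrite gt_eqF.
rewrite indic_ge indicE; case: (leP c (X w)) => h /=.
  by rewrite memNset/= ?add0r; [field|apply/negP; rewrite -leNgt].
by rewrite mem_set//=; field.
Qed.

(** [c / X <= 1] on the event [X >= c], whose probability is [1 - F c]. *)
Let H_bound c : 1 <= c -> 0 <= c * H c <= 1 - F c.
Proof.
move=> c1; have c0 : 0 < c by exact: lt_le_trans c1.
rewrite /H -(RintegralZl c mD (iH c)).
apply/andP; split.
  apply: Rintegral_ge0 => w Dw; rewrite indic_ge.
  by rewrite mulr_ge0 ?(ltW c0)// divr_ge0// ltW.
have -> : 1 - F c = \int[P]_(w in D) \1_[set w | c <= X w] w.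
  rewrite /Rintegral -(integral_full_set mD PD)//.
  rewrite integral_indic// setIT /F -[1]/(fine 1%:E) -fineB ?fin_num_measure//.
  congr fine; rewrite -probability_setC//; congr (P _).
  by apply/seteqP; split => w /=; rewrite leNgt => /negP.
apply: le_Rintegral => //.
- exact: (integrableZl mD c (iH c)).
- by apply: (integrableS measurableT) => //; exact: integrable_indic.
- move=> w Dw; rewrite indic_ge; case: (leP c (X w)) => h; rewrite /= ?mul0r ?mulr0// mul1r.
  by rewrite ler_pdivrMr// mul1r.
Qed.

(** As [c] grows, [F c] tends to 1, so [c * H c] tends to 0 by [H_bound], and the limit of [FH] is
    the claim. *)
Let KE : (alpha + 1) * K = alpha.
Proof.
have lim e : 0 < e -> exists2 c, 1 <= c & 1 - e < F c.
  move=> e0; have /fine_cvg := cvg_cdfy1 X.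
  move=> /cvgrPdist_lt /(_ e e0) [M [_ hM]].
  pose c := Num.max M 1 + 1.
  have Mc : M < c by rewrite ltr_pwDr// le_max lexx.
  (* [cdf] is defined with a weak inequality and [F] with a strict one; the shift by 1 passes from
     [X <= c] to [X < c + 1]. *)
  exists (c + 1); first by rewrite /c ler_wpDr// ler_wpDr// le_max lexx orbT.
  have := hM c Mc => /=; rewrite ltr_norml => /andP[_].
  rewrite ltrBlDr -ltrBlDl => /lt_le_trans; apply.
  apply: fine_le; rewrite /cdf ?fin_num_measure//.
  change (P (X @^-1` `]-oo, c]) <= P [set w | (X w < c + 1)%R])%E.
  apply: le_measure; rewrite ?inE//; first exact: measurable_funPTI.
  by move=> w /=; rewrite in_itv/= => /le_lt_trans; apply; rewrite ltrDl.
have a0 : 0 < alpha + 1 by rewrite addr_gt0.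
apply/eqP; rewrite eq_le; apply/andP; split; apply/ler_addgt0Pr => e e0.
  have [c c1 Fc] := lim _ (divr_gt0 e0 a0).
  have /andP[_ h2] := H_bound c1; have := FH c1.
  have : (alpha + 1) * (c * H c) <= (alpha + 1) * (1 - F c) by rewrite ler_pM2l.
  have : (alpha + 1) * (1 - F c) < e by rewrite mulrC -ltr_pdivlMr//; lra.
  have : alpha * F c <= alpha * 1.
    rewrite ler_pM2l//; have /andP[h3 _] := H_bound c1; lra.
  rewrite mulrBr; lra.
have [c c1 Fc] := lim _ (divr_gt0 e0 alpha0).
have /andP[h1 _] := H_bound c1; have := FH c1.
have : 0 <= (alpha + 1) * (c * H c) by rewrite mulr_ge0// ltW.
have : alpha * (1 - F c) < e by rewrite mulrC -ltr_pdivlMr//; lra.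
rewrite mulrBr [in X in _ -> _ -> X -> _]mulrBr; lra.
Qed.

Let S (x : R) := 1 - fine (P [set w | X w < x]).

(** Inserting [KE] into [FH] gives [alpha * S x / x = (alpha + 1) * H x], which turns [F_increment]
    into these bounds. *)
Lemma survival_increment (c c' : R) : 1 <= c -> c <= c' ->
  (c' - c) * (alpha * S c' / c') <= S c - S c' <= (c' - c) * (alpha * S c / c).
Proof.
move=> c1 cc'; have c'1 := le_trans c1 cc'.
have SH x : 1 <= x -> alpha * S x / x = (alpha + 1) * H x.
  move=> x1; have x0 : x != 0 by rewrite gt_eqF// (lt_le_trans ltr01).
  have := FH x1; rewrite mulrBr KE => h.
  have -> : alpha * S x = (alpha + 1) * H x * x by rewrite /S -/(F x) mulrBr mulr1 h; ring.
  by rewrite mulfK.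
have := F_increment c1 cc'; rewrite (mulrCA _ (c' - c)) (mulrCA _ (c' - c)) -!SH//.
have -> : S c - S c' = F c' - F c by rewrite /S -/(F c) -/(F c'); ring.
by [].
Qed.

Lemma survival1 : S 1 = 1.
Proof. by rewrite /S -/(F 1) F1 subr0. Qed.

End identity.

(** * Tails of the Pareto density *)

Lemma ge0_is_derive_FTC2y (R : realType) (f F : R -> R) (a l : R) :
  (forall x, a <= x -> 0 <= f x) -> (forall x : R, a <= x -> derivable f x 1) ->
  (forall x : R, a <= x -> is_derive x 1 F (f x)) ->
  F x @[x --> +oo] --> l ->
  (\int[lebesgue_measure]_(x in `[a, +oo[) (f x)%:E = (l - F a)%:E)%E.
Proof.
move=> f0 df dF Fl; rewrite (@ge0_continuous_FTC2y _ f F a l)//.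
- by apply: derivable_within_continuous => x; rewrite in_itv/= andbT; exact: df.
- by move=> x /ltW ax; case: (dF _ ax).
- apply: cvg_at_right_filter; apply: (@differentiable_continuous _ R R).
  by apply/derivable1_diffP; case: (dF _ (lexx a)).
- by move=> x; rewrite in_itv/= andbT derive1E => /ltW ax; case: (dF _ ax).
Qed.

Lemma powRN_cvg0 (R : realType) (a : R) : 0 < a -> x `^ (- a) @[x --> +oo] --> (0 : R).
Proof.
move=> a0; apply/cvgr0Pnorm_le => e e0; near=> x.
have M0 : 0 < e `^ (- a^-1) by rewrite powR_gt0.
have Mx : e `^ (- a^-1) <= x by near: x; apply: nbhs_pinfty_ge; exact: num_real.
have x0 : 0 < x by exact: lt_le_trans Mx.
rewrite ger0_norm ?powR_ge0// powRN.
rewrite -[leRHS]invrK lef_pV2 ?posrE ?invr_gt0 ?powR_gt0//.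
have -> : e^-1 = (e `^ (- a^-1)) `^ a.
  by rewrite -powRrM mulNr mulVf ?gt_eqF// powR_inv1// ltW.
by rewrite ge0_ler_powR ?nnegrE ?(ltW a0) ?(ltW M0)// ltW.
Unshelve. all: end_near. Qed.

Lemma measurable_pareto_pdf (R : realType) (alpha : R) :
  measurable_fun setT (pareto_pdf alpha).
Proof.
apply: measurable_fun_ifT => //.
  by apply: measurable_fun_ler.
by apply: measurable_funM => //; exact: measurable_powR.
Qed.

Lemma pareto_pdf_ge0 (R : realType) (alpha x : R) : 0 < alpha -> 0 <= pareto_pdf alpha x.
Proof.
by move=> a0; rewrite /pareto_pdf; case: ifP => // _; rewrite mulr_ge0 ?powR_ge0// ltW.
Qed.

Lemma pareto_tail (R : realType) (alpha c : R) : 0 < alpha -> 1 <= c ->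
  (\int[lebesgue_measure]_(x in `[c, +oo[) (pareto_pdf alpha x)%:E = (c `^ (- alpha))%:E)%E.
Proof.
move=> a0 c1; pose F (x : R) : R := - (x `^ (- alpha)).
transitivity (\int[lebesgue_measure]_(x in `[c, +oo[) (alpha * x `^ (- alpha - 1))%:E)%E.
  apply: eq_integral => x; rewrite inE/= in_itv/= andbT => cx.
  by rewrite /pareto_pdf (le_trans c1).
have dF (x : R) : c <= x -> is_derive x 1 F (alpha * x `^ (- alpha - 1)).
  move=> cx; have x0 : 0 < x by rewrite (lt_le_trans _ cx)// (lt_le_trans _ c1).
  have dp := is_derive1_powR (- alpha) x0.
  by apply: is_derive_eq; rewrite mulNr opprK.
rewrite (ge0_is_derive_FTC2y _ _ dF (l := 0)) ?sub0r ?opprK//.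
- by move=> x _; rewrite mulr_ge0 ?powR_ge0// ltW.
- move=> x cx; have x0 : 0 < x by rewrite (lt_le_trans _ cx)// (lt_le_trans _ c1).
  by have dp := is_derive1_powR (- alpha - 1) x0; exact: ex_derive.
- by rewrite -oppr0; apply: cvgN; exact: powRN_cvg0.
Qed.

Lemma pareto_tail_le1 (R : realType) (alpha c : R) : 0 < alpha -> c <= 1 ->
  (\int[lebesgue_measure]_(x in `[c, +oo[) (pareto_pdf alpha x)%:E = 1)%E.
Proof.
move=> a0 c1.
transitivity ((1 `^ (- alpha))%:E : \bar R); last by rewrite powR1.
rewrite -(pareto_tail a0 (lexx 1)).
rewrite [LHS]integral_mkcond [RHS]integral_mkcond; apply: eq_integral => x _.
rewrite !patchE !mem_setE !in_itv/= !andbT.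
rewrite /pareto_pdf; case: (leP 1 x) => [x1|x1]; last by rewrite if_same.
by rewrite (le_trans c1).
Qed.

(** * Laws determined by their tails *)

(** Packages the integral of a density as a measure, so that uniqueness of measures agreeing on a
    generating class can be applied to it. *)
Lemma density_measure_exists d (T : measurableType d) (R : realType)
    (mu : {measure set T -> \bar R}) (f : T -> R) :
  (forall x, 0 <= f x) -> measurable_fun setT f ->
  exists nu : {measure set T -> \bar R},
    forall A, nu A = (\int[mu]_(x in A) (f x)%:E)%E.
Proof.
move=> f0 mf; pose nu A := (\int[mu]_(x in A) (f x)%:E)%E.
have nu0 : nu set0 = 0%E by exact: integral_set0.
have nu_ge0 A : (0 <= nu A)%E by apply: integral_ge0 => x _; rewrite lee_fin.
have nu_additive : semi_sigma_additive nu.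
  move=> /= A mA tA mUA; rewrite /nu; apply: cvg_toP.
    apply: ereal_nondecreasing_is_cvgn => m n mn.
    by apply: lee_sum_nneg_natr => // k _ _; exact: nu_ge0.
  rewrite ge0_integral_bigcup//=.
  - by apply/measurable_funTS/measurable_EFinP.
  - by move=> x _; rewrite lee_fin.
pose nu_isMeasure := isMeasure.Build _ _ _ nu nu0 nu_ge0 nu_additive.
pose nu' : {measure set T -> \bar R} := HB.pack nu nu_isMeasure.
by exists nu'.
Qed.

(* [lebesgue_measure] lives on [measurableTypeR R], whose canonical measurable
   structure is convertible to the one of [R] without being unifiable with it. *)
Lemma RV_measurableTypeR d (T : measurableType d) (R : realType) (X : {mfun T >-> R}) :
  exists X' : {mfun T >-> measurableTypeR R}, X' = X :> (T -> R).
Proof.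
have mX : measurable_fun setT X by exact: measurable_funP.
pose mX' := isMeasurableFun.Build _ _ T (measurableTypeR R) X mX.
pose X' : {mfun T >-> measurableTypeR R} := HB.pack (X : T -> measurableTypeR R) mX'.
by exists X'.
Qed.

(** The rays [[c, +oo[] are stable under intersection and generate the Borel sets, so agreement of
    the two measures on them suffices. *)
Lemma pareto_distributed_tail d (T : measurableType d) (R : realType)
    (P : probability T R) (alpha : R) (X : {RV P >-> R}) :
  0 < alpha ->
  (forall c, 1 <= c -> P [set w | c <= X w] = (c `^ (- alpha))%:E) ->
  pareto_distributed alpha X.
Proof.
move=> a0 tail; split.
- exact: measurable_pareto_pdf.
- by move=> x; exact: pareto_pdf_ge0.
have [nu nuE] := @density_measure_exists _ _ _ (@lebesgue_measure R) (pareto_pdf alpha)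
  (fun x => pareto_pdf_ge0 x a0) (@measurable_pareto_pdf R alpha).
have [X' X'E] := RV_measurableTypeR X.
have rays c : distribution P X' `[c, +oo[%classic = nu `[c, +oo[%classic.
  rewrite nuE /distribution /pushforward X'E.
  have -> : X @^-1` `[c, +oo[ = [set w | c <= X w].
    by apply/seteqP; split => w /=; rewrite in_itv/= andbT.
  (* For [c < 1] the ray contains [[1, +oo[], which already has full mass under both measures. *)
  have [c1|/ltW c1] := leP 1 c; first by rewrite tail// pareto_tail.
  have mX b := measurable_RV_ge X b.
  rewrite pareto_tail_le1//; apply/eqP; rewrite eq_le probability_le1//=.
  have <- : P [set w | 1 <= X w] = 1%E by rewrite tail// powR1.
  by apply: le_measure; rewrite ?inE// => w; exact: le_trans.
move=> A mA; rewrite -nuE.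
have -> : distribution P X A = distribution P X' A.
  by rewrite /distribution /pushforward X'E.
apply: (@measure_unique _ R (measurableTypeR R) (@RGenCInfty.G R)
  (fun n => `[(- n%:R)%R, +oo[%classic) _ _ _ _ (distribution P X') nu _ _ A mA).
- exact: RGenCInfty.measurableE.
- move=> _ _ [x ->] [y ->]; exists (Num.max x y).
  by apply/seteqP; split => z /=; rewrite !in_itv/= !andbT ge_max => /andP.
- by move=> n; exists (- n%:R).
- apply/seteqP; split => // x _.
  exists (Num.bound `|x|) => //=; rewrite in_itv/= andbT lerNl.
  by rewrite (le_trans (ler_norm (- x)))// normrN ltW// archi_boundP.
- by move=> _ [c ->]; exact: rays.
- by move=> n; rewrite (le_lt_trans (probability_le1 _ _)) ?ltry.
Qed.

(** * Integration by parts for a Pareto variable *)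

(** The density makes the law of [X] absolutely continuous. Its Radon-Nikodym derivative agrees with
    [f] almost everywhere, both having the same integral over every measurable set. *)
Lemma expectation_density d (T : measurableType d) (R : realType)
    (P : probability T R) (X : {RV P >-> R}) (f : R -> R) (g : R -> \bar R) :
  has_density X f -> measurable_fun setT g -> (forall x, 0 <= g x)%E ->
  (\int[P]_w g (X w) = \int[lebesgue_measure]_x (g x * (f x)%:E))%E.
Proof.
move=> [mf f0 fE] mg g0; have [X' X'E] := RV_measurableTypeR X.
have fE' A : measurable A ->
    distribution P X' A = (\int[lebesgue_measure]_(x in A) (f x)%:E)%E.
  by move=> mA; rewrite -fE// /distribution /pushforward X'E.
have mfE : measurable_fun (setT : set (measurableTypeR R)) (EFin \o f).
  exact/measurable_EFinP.
have dom : distribution P X' `<< (@lebesgue_measure R).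
  apply/null_content_dominatesP => A mA A0.
  rewrite fE'//; apply: null_set_integral => //; exact: measurable_funTS.
have -> : (\int[P]_w g (X w) = \int[distribution P X']_y g y)%E.
  by rewrite ge0_integral_distribution// X'E.
rewrite -(Radon_Nikodym_SigmaFinite.change_of_variables dom)//.
apply: ae_eq_integral => //.
- apply: emeasurable_funM => //.
  exact: (measurable_int _ (Radon_Nikodym_SigmaFinite.f_integrable dom)).
- exact: emeasurable_funM.
apply: ae_eqe_mul2l; apply: integral_ae_eq => //.
- exact: Radon_Nikodym_SigmaFinite.f_integrable.
- move=> A _ mA; rewrite -(Radon_Nikodym_SigmaFinite.f_integral dom)//.
  exact: fE'.
Qed.

(* The summand [1] makes the integrand nonnegative, as required by the improper
   fundamental theorem of calculus; it contributes the total mass of the density. *)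
Lemma pareto_integral (R : realType) (alpha t : R) : 0 < alpha -> 0 < t ->
  (\int[lebesgue_measure]_(x in `[(1%R : R), +oo[)
    ((1 - expR (- t * x) + (alpha + 1) / x * ((expR (- t) - expR (- t * x)) / t))
      * (alpha * x `^ (- alpha - 1)))%R%:E = 1)%E.
Proof.
move=> a0 t0.
(* The first term is a primitive of the density. The product rule on the second yields the two other
   summands of the integrand. [F] rises from -1 at 1 to 0 at infinity. *)
pose F (x : R) : R :=
  - (x `^ (- alpha)) - alpha / t * (expR (- t) - expR (- t * x)) * x `^ (- alpha - 1).
set f := (X in (\int[_]_(x in _) (X x)%:E)%E).
have dF (x : R) : 1 <= x -> is_derive x 1 F (f x).
  move=> x1; have x0 : 0 < x by rewrite (lt_le_trans _ x1).
  have d1 := is_derive1_powR (- alpha) x0.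
  have d2 := is_derive1_powR (- alpha - 1) x0.
  have E : x `^ (- alpha - 1 - 1) = x `^ (- alpha - 1) / x.
    by rewrite powRB ?powRr1 ?(ltW x0)// (gt_eqF x0) implybT.
  apply: is_derive_eq; rewrite /f /GRing.scale/= E.
  by field; rewrite !gt_eqF.
transitivity ((0 - F 1)%:E : \bar R); last first.
  by rewrite /F !powR1 !mulr1 subrr mulr0 subr0 opprK add0r.
apply: (ge0_is_derive_FTC2y _ _ dF).
- move=> x x1; have x0 : 0 < x by rewrite (lt_le_trans _ x1).
  have e1 : expR (- t * x) <= 1.
    by rewrite expR_le1 mulNr oppr_le0 mulr_ge0// ltW.
  have e2 : expR (- t * x) <= expR (- t).
    by rewrite ler_expR mulNr lerN2 ler_peMr// ltW.
  apply: mulr_ge0; last by rewrite mulr_ge0 ?powR_ge0// ltW.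
  apply: addr_ge0; first by rewrite subr_ge0.
  apply: mulr_ge0; apply: divr_ge0; rewrite ?subr_ge0 ?addr_ge0 ?(ltW x0) ?(ltW t0)//.
  exact: ltW.
- move=> x x1; have x0 : 0 < x by rewrite (lt_le_trans _ x1).
  have d2 := is_derive1_powR (- alpha - 1) x0.
  have d3 : is_derive x 1 (@GRing.inv R) (- x ^- 2 *: 1).
    by apply: is_deriveV; rewrite gt_eqF.
  exact: ex_derive.
- have expRt0 : expR (- t * x) @[x --> +oo] --> (0 : R).
    rewrite (_ : (fun x => expR (- t * x)) = (fun z => expR (- z)) \o (fun z => t * z)).
      apply: (@cvg_comp _ _ _ _ _ _ (pinfty_nbhs R)); last exact: cvgr_expR.
      exact: gt0_cvgMry.
    by apply/funext => x; rewrite /= mulNr.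
  have a1 : 0 < alpha + 1 by rewrite addr_gt0.
  have := cvgB (cvgN (powRN_cvg0 a0))
    (cvgM (cvgM (cvg_cst (alpha / t)) (cvgB (cvg_cst (expR (- t))) expRt0)) (powRN_cvg0 a1)).
  by rewrite mulr0 oppr0 addr0 opprD; exact.
Qed.

(** On the almost sure event [X >= 1] both [h1] and [h2] are bounded, and [pareto_integral] says
    that [1 - h1 + h2] has expectation 1; so [h1] and [h2] have the same expectation. *)
Lemma pareto_identity d (T : measurableType d) (R : realType)
    (P : probability T R) (alpha : R) (X : {RV P >-> R}) (t : R) :
  0 < alpha -> pareto_distributed alpha X -> 0 < t ->
  laplace_transform X t =
  'E_P[fun w => ((alpha + 1) / X w * ((expR (- t) - expR (- t * X w)) / t))%R]%E.
Proof.
move=> a0 hX t0.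
pose D := [set w | 1 <= X w].
have mD : measurable D := measurable_RV_ge X 1.
have PD : P D = 1%E.
  case: hX => _ _ hX; rewrite -(pareto_tail_le1 a0 (lexx 1)) -hX//.
  rewrite /distribution /pushforward; congr (P _).
  by apply/seteqP; split => w /=; rewrite in_itv/= andbT.
pose h1 (x : R) : R := expR (- t * x).
pose h2 (x : R) : R := (alpha + 1) / x * ((expR (- t) - expR (- t * x)) / t).
have mh1 : measurable_fun setT h1.
  by apply: (measurableT_comp (@measurable_expR R)); exact: measurable_funM.
have mh2 : measurable_fun setT h2.
  apply: measurable_funM; first by apply: measurable_funM => //; exact: measurable_inv.
  by apply: measurable_funM => //; apply: measurable_funB.
have mX : measurable_fun setT X by exact: measurable_funP.
have mh1X : measurable_fun setT (h1 \o X) by exact: measurableT_comp.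
have mh2X : measurable_fun setT (h2 \o X) by exact: measurableT_comp.
have h1_01 x : 1 <= x -> 0 <= h1 x <= 1.
  move=> x1; rewrite expR_ge0 expR_le1 mulNr oppr_le0 mulr_ge0 ?(ltW t0)//.
  exact: le_trans x1.
have h2_bnd x : 1 <= x -> 0 <= h2 x <= (alpha + 1) / t.
  move=> x1; have x0 : 0 < x by rewrite (lt_le_trans _ x1).
  have e0 : 0 <= expR (- t) - expR (- t * x).
    by rewrite subr_ge0 ler_expR mulNr lerN2 ler_peMr// ltW.
  have e1 : expR (- t) - expR (- t * x) <= 1.
    have := expR_ge0 (- t * x); have : expR (- t) <= 1 by rewrite expR_le1 oppr_le0 ltW.
    lra.
  have a1 : 0 <= alpha + 1 by rewrite addr_ge0// ltW.
  rewrite /h2; apply/andP; split.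
    by rewrite mulr_ge0// divr_ge0// ltW.
  rewrite mulrA ler_pM2r ?invr_gt0//.
  rewrite -mulrA ler_piMr// mulrC ler_pdivrMr// mul1r.
  exact: le_trans x1.
have i1 : P.-integrable D (EFin \o (h1 \o X)).
  apply: (@le_integrable _ _ _ P D mD _ (EFin \o cst 1)).
  - by apply/measurable_EFinP/measurable_funTS.
  - move=> w Dw /=; rewrite lee_fin normr1 ger0_norm; by case/andP: (h1_01 _ Dw).
  - exact: finite_measure_integrable_cst.
have i2 : P.-integrable D (EFin \o (h2 \o X)).
  apply: (@le_integrable _ _ _ P D mD _ (EFin \o cst ((alpha + 1) / t))).
  - by apply/measurable_EFinP/measurable_funTS.
  - move=> w Dw /=; rewrite lee_fin; have /andP[l0 l1] := h2_bnd _ Dw.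
    by rewrite !ger0_norm// (le_trans l0).
  - exact: finite_measure_integrable_cst.
have ic : P.-integrable D (EFin \o cst 1) by exact: finite_measure_integrable_cst.
(* The value 0 below 1 makes [g] nonnegative everywhere, as [expectation_density] requires; the
   Pareto density vanishes there. *)
pose g (x : R) : R := if 1 <= x then 1 - h1 x + h2 x else 0.
have mg : measurable_fun setT g.
  apply: measurable_fun_ifT => //; first exact: measurable_fun_ler.
  by apply: measurable_funD => //; exact: measurable_funB.
have g0 x : 0 <= g x.
  rewrite /g; case: ifPn => // x1; have /andP[] := h1_01 _ x1; have /andP[] := h2_bnd _ x1.
  lra.
have gE : (\int[P]_(w in D) (1 - h1 (X w) + h2 (X w))%R%:E = 1)%E.
  transitivity (\int[P]_(w in D) (g (X w))%:E)%E.
    by apply: eq_integral => w; rewrite inE => Dw; rewrite /g ifT.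
  rewrite -(integral_full_set mD PD); last exact: measurableT_comp.
  rewrite (expectation_density (g := EFin \o g) hX)//; last 1 first.
    exact/measurable_EFinP.
  rewrite -(pareto_integral a0 t0) [RHS]integral_mkcond; apply: eq_integral => x _.
  rewrite patchE mem_setE in_itv/= andbT /g /pareto_pdf.
  by case: ifP; rewrite ?mul0e.
rewrite /laplace_transform unlock.
rewrite (integral_full_set mD PD mh1X) (integral_full_set mD PD mh2X).
have := congr1 fine gE.
rewrite -/(Rintegral P D (fun w => 1 - h1 (X w) + h2 (X w))).
rewrite (RintegralD mD (integrableB mD ic i1) i2) (RintegralB mD ic i1).
have -> : Rintegral P D (cst 1) = 1.
  by rewrite Rintegral_cst// mul1r; exact: (congr1 fine PD).
move=> h; rewrite -(fineK (integrable_fin_num mD i1)) -(fineK (integrable_fin_num mD i2)).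
congr EFin; rewrite /Rintegral/= in h *; lra.
Qed.

Theorem theorem1 (R : realType) (d : measure_display) (T : measurableType d)
    (P : probability T R) (alpha : R) (X : {RV P >-> R}) (f : R -> R)
    (halpha : 0 < alpha)
    (hXpos : P [set w | 0 < X w] = 1%E)
    (hdens : has_density X f)
    (hdiff : differentiable_density f)
    (hint : ('E_P[fun w => (`| X w * f^`()%classic (X w) / f (X w) |)%R] < +oo)%E) :
  pareto_distributed alpha X <->
  (forall t : R, 0 < t ->
    laplace_transform X t =
    'E_P[fun w => ((alpha + 1) / X w * ((expR (- t) - expR (- t * X w)) / t))%R]%E).
Proof.
split=> [hX t|hE]; first exact: pareto_identity.
(* Points are Lebesgue-null, so a law with a density has no atom; this covers the point where the
   cutoffs do not tend to the indicator. *)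
have noatom c : P [set w | X w = c] = 0%E.
  have [mf _ fE] := hdens; have := fE [set c] (measurable_set1 c).
  rewrite [RHS]null_set_integral//.
  - by apply/measurable_funTS/measurable_EFinP.
  - exact: lebesgue_measure_set1.
pose S c := 1 - fine (P [set w | X w < c]).
have PltE c : (P [set w | X w < c] = (fine (P [set w | X w < c]))%:E).
  by rewrite fineK// fin_num_measure//; exact: measurable_RV_lt.
have S01 c : 0 <= S c <= 1.
  rewrite /S subr_ge0 gerBl fine_ge0// andbT -lee_fin -PltE.
  by apply: probability_le1; exact: measurable_RV_lt.
apply: pareto_distributed_tail => // c c1.
rewrite -(survivalE halpha S01 (survival1 halpha hXpos hE noatom)
  (survival_increment halpha hXpos hE noatom) c1) /S EFinB -PltE.
have -> : [set w | c <= X w] = ~` [set w | X w < c].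
  by apply/seteqP; split => w /=; rewrite leNgt => /negP.
by rewrite probability_setC//; exact: measurable_RV_lt.
Qed.
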